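(* The HyperVPA model-checking problem (given a finite transition system $\mathfrak{T}$ and a HyperVPA formula $\phi$, decide whether $\mathfrak{T}\models\phi$) restricted to $\Pi_{2,2}$ formulas is undecidable.
   Context: A transition system $\mathfrak{T}=(V,E,V_I,\lambda)$ has a finite vertex set $V$, edges $E\subseteq V\times V$ (every vertex has a successor), nonempty initial set $V_I$, and labelling $\lambda:V\to\Sigma$; $\mathrm{Tr}(\mathfrak{T})$ is the set of label sequences $\lambda(v_0)\lambda(v_1)\cdots$ of infinite paths starting in $V_I$. The merge $\langle w_0,\dots,w_{k-1}\rangle\in(\Sigma^k)^\omega$ of infinite words has $n$-th letter $(w_0(n),\dots,w_{k-1}(n))$. An $\omega$-PDA $\mathcal{A}=(Q,\Sigma,\Gamma,q_I,\Delta,F)$ has finite states, initial state $q_I$, stack alphabet $\Gamma$ with bottom symbol $\bot\notin\Gamma$, Büchi accepting set $F$, and transitions $(q,X,a,q',\gamma')\in Q\times(\Gamma\cup\{\bot\})\times(\Sigma\cup\{\epsilon\})\times Q\times(\Gamma\cup\{\bot\})^{\le2}$ (never writing/deleting $\bot$) turning $(q,\gamma X)$ into $(q',\gamma\gamma')$; it accepts $w\in\Sigma^\omega$ if some run from $(q_I,\bot)$ reads $w$ and visits $F$ infinitely often. An $\omega$-VPA is an $\omega$-PDA without $\epsilon$-transitions whose input alphabet has a partition $(\Sigma_c,\Sigma_r,\Sigma_s)$ such that letters in $\Sigma_c$ (calls) are only read by transitions $(q,X,a,q',XY)$, letters in $\Sigma_r$ (returns) only by transitions $(q,X,a,q',\epsilon)$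 with $X\ne\bot$ or $(q,\bot,a,q',\bot)$, and letters in $\Sigma_s$ (skips) only by $(q,X,a,q',X)$. A HyperVPA formula is $\phi=Q_0\pi_0.\ldots Q_{k-1}\pi_{k-1}.\ \mathcal{A}$ with $Q_i\in\{\exists,\forall\}$ and $\mathcal{A}$ an $\omega$-VPA over $\Sigma^k$; $\mathfrak{T}\models\phi$ if, quantifying each $\pi_i$ over $\mathrm{Tr}(\mathfrak{T})$ as indicated, the merge of the chosen traces lies in $L(\mathcal{A})$. An $\omega$-VPA of arity $k$ is controlled by $I\subseteq\{0,\dots,k-1\}$ if any two letters $(a_0,\dots,a_{k-1})$, $(b_0,\dots,b_{k-1})$ with $a_i=b_i$ for all $i\in I$ are both calls, both returns, or both skips. $\Pi_n$ (resp. $\Sigma_n$) is the class of formulas with $n-1$ quantifier alternations starting with a universal (resp. existential) quantifier; $\Pi_{n,j}$ consists of the formulas in $\Pi_n$ whose automaton is controlled by the set of indices of the variables of the $j$-th quantifier block. Thus $\Pi_{2,2}$ consists of formulas $\forall\pi_0\ldots\forall\pi_{m-1}.\ \exists\pi_m\ldots\exists\pi_{k-1}.\ \mathcal{A}$ with $\mathcal{A}$ controlled by $\{m,\dots,k-1\}$. *)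

(* Defs.v *)
From HB Require Import structures.
From mathcomp Require Import all_boot.

Set Implicit Arguments.
Unset Strict Implicit.
Unset Printing Implicit Defensive.

Definition word (S : Type) := nat -> S.

Definition merge_words (S : Type) (k : nat) (ws : k.-tuple (word S)) :
    word (k.-tuple S) :=
  fun n => [tuple of [seq w n | w <- ws]].

Definition infinitely_often (P : nat -> Prop) : Prop :=
  forall n, exists2 m, n <= m & P m.

Record transition_system (V S : finType) := TransitionSystem {
  ts_edge : {set V * V};
  ts_init : {set V};
  ts_label : {ffun V -> S};
  ts_edge_total : [forall v, [exists u, (v, u) \in ts_edge]];
  ts_init_neq0 : ts_init != set0
}.

Definition trace (V S : finType) (T : transition_system V S) (w : word S) :
    Prop :=
  exists v : nat -> V,
    [/\ v 0 \in ts_init T,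
        forall n, (v n, v n.+1) \in ts_edge T
      & forall n, w n = ts_label T (v n)].

(* [None : option G] is the bottom symbol and [None : option S] is epsilon.
   A stack content is listed from bottom to top. *)
Definition transition (Q S G : Type) : Type :=
  (Q * option G * option S * Q * seq (option G))%type.

(* The bottom symbol is neither written above the bottom nor deleted. *)
Definition stack_op_ok (G : eqType) (X : option G) (g : seq (option G)) :
    bool :=
  (size g <= 2) &&
  (if X is None then
     if g is None :: g' then None \notin g' else false
   else None \notin g).

Definition transition_ok (Q S : Type) (G : eqType) (t : transition Q S G) :
    bool :=
  let: (_, X, _, _, g) := t in stack_op_ok X g.

(* The finite transition relation is given as a list. *)
Record omega_pda (Q S G : finType) := OmegaPDA {
  pda_init : Q;
  pda_trans : seq (transition Q S G);
  pda_final : {set Q};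
  pda_trans_ok : all (@transition_ok Q S G) pda_trans
}.

Definition config (Q G : Type) : Type := (Q * seq (option G))%type.

Definition pda_step (Q S G : finType) (A : omega_pda Q S G)
    (c : config Q G) (a : option S) (c' : config Q G) : Prop :=
  exists q X q' g s,
    [/\ (q, X, a, q', g) \in pda_trans A,
        c = (q, rcons s X)
      & c' = (q', s ++ g)].

(* The concatenation of the labels [l 0], [l 1], ..., with epsilons erased, is
   the infinite word [w]. *)
Definition reads (S : Type) (l : nat -> option S) (w : word S) : Prop :=
  forall n, exists i, pmap id (mkseq l i) = mkseq w n.

Definition pda_lang (Q S G : finType) (A : omega_pda Q S G) (w : word S) :
    Prop :=
  exists (c : nat -> config Q G) (l : nat -> option S),
    [/\ c 0 = (pda_init A, [:: None]),
        forall i, pda_step A (c i) (l i) (c i.+1),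
        reads l w
      & infinitely_often (fun i => (c i).1 \in pda_final A)].

Inductive letter_kind := Call | Return | Skip.

Definition letter_kind_code (x : letter_kind) : option bool :=
  match x with Call => Some true | Return => Some false | Skip => None end.

Definition letter_kind_decode (x : option bool) : letter_kind :=
  match x with Some true => Call | Some false => Return | None => Skip end.

Lemma letter_kind_codeK : cancel letter_kind_code letter_kind_decode.
Proof. by case. Qed.

HB.instance Definition _ :=
  Countable.copy letter_kind (can_type letter_kind_codeK).

(* [kind] is the partition of the alphabet into calls, returns and skips. *)
Definition visible_transition (Q S G : finType) (kind : S -> letter_kind)
    (t : transition Q S G) : bool :=
  let: (_, X, oa, _, g) := t in
  if oa is Some a then
    match kind a with
    | Call => if g is [:: X'; _] then X' == X else false
    | Return => if X is Some _ then g == [::] else g == [:: None]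
    | Skip => g == [:: X]
    end
  else false.

Record omega_vpa (Q S G : finType) := OmegaVPA {
  vpa_pda :> omega_pda Q S G;
  vpa_kind : {ffun S -> letter_kind};
  vpa_visible : all (visible_transition vpa_kind) (pda_trans vpa_pda)
}.

Definition controlled_by (Q S G : finType) (k : nat)
    (A : omega_vpa Q (k.-tuple S : finType) G) (I : {set 'I_k}) : Prop :=
  forall a b : k.-tuple S,
    (forall i, i \in I -> tnth a i = tnth b i) -> vpa_kind A a = vpa_kind A b.

Inductive quantifier := Forall | Exists.

Definition quantifier_code (q : quantifier) : bool :=
  if q is Exists then true else false.

Definition quantifier_decode (b : bool) : quantifier :=
  if b then Exists else Forall.

Lemma quantifier_codeK : cancel quantifier_code quantifier_decode.
Proof. by case. Qed.

HB.instance Definition _ :=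
  Countable.copy quantifier (can_type quantifier_codeK).

Record hypervpa (Q S G : finType) := HyperVPA {
  quant_prefix : seq quantifier;
  matrix : omega_vpa Q ((size quant_prefix).-tuple S : finType) G
}.

(* The variables range over the elements of [W] satisfying [D]; the i-th
   component of the tuple given to [P] is the value of the i-th variable. *)
Fixpoint quantify (W : Type) (D : W -> Prop) (qs : seq quantifier) :
    ((size qs).-tuple W -> Prop) -> Prop :=
  match qs return ((size qs).-tuple W -> Prop) -> Prop with
  | [::] => fun P => P [tuple]
  | Forall :: qs' => fun P =>
      forall w, D w -> quantify D (fun ws => P [tuple of w :: ws])
  | Exists :: qs' => fun P =>
      exists2 w, D w & quantify D (fun ws => P [tuple of w :: ws])
  end.

Definition models (V Q S G : finType) (T : transition_system V S)
    (phi : hypervpa Q S G) : Prop :=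
  quantify (trace T) (fun ws => pda_lang (matrix phi) (merge_words ws)).

Definition alternations (qs : seq quantifier) : nat :=
  count id (pairmap (fun q q' => q != q') (head Forall qs) qs).

(* Blocks are numbered from 1. *)
Definition block (qs : seq quantifier) (j : nat) : {set 'I_(size qs)} :=
  [set i : 'I_(size qs) | (alternations (take i.+1 qs)).+1 == j].

Definition Pi_class (n : nat) (Q S G : finType) (phi : hypervpa Q S G) :
    Prop :=
  ohead (quant_prefix phi) = Some Forall /\ (alternations (quant_prefix phi)).+1 = n.

Definition Pi_controlled_class (n j : nat) (Q S G : finType)
    (phi : hypervpa Q S G) : Prop :=
  Pi_class n phi /\ controlled_by (matrix phi) (block (quant_prefix phi) j).

(* In order to be a finite object, an instance has initial segments of the
   natural numbers as vertices, states, letters and stack symbols. *)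
Record mc_instance := MCInstance {
  mc_vertices : nat;
  mc_states : nat;
  mc_letters : nat;
  mc_stack : nat;
  mc_system : transition_system 'I_mc_vertices 'I_mc_letters;
  mc_formula : hypervpa 'I_mc_states 'I_mc_letters 'I_mc_stack
}.

(* All components are explicitly listed finite data, so [pickle] only
   nests the computable bijection [CodeSeq.code : seq nat -> nat]: ordinals are
   coded by their values, and sets and finite functions by their graphs. *)
Definition encode (x : mc_instance) : nat :=
  let: A := matrix (mc_formula x) in
  CodeSeq.code
    [:: mc_vertices x; mc_states x; mc_letters x; mc_stack x;
        pickle (ts_edge (mc_system x));
        pickle (ts_init (mc_system x));
        pickle (ts_label (mc_system x));
        pickle (quant_prefix (mc_formula x));
        pickle (vpa_kind A);
        pickle (pda_init A);
        pickle (pda_trans A);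
        pickle (pda_final A)].

Lemma encode_inj : injective encode.
Proof.
move=> [nV nQ nS nG [E I L hE hI] [qs [[q0 D F hD] K hK]]].
move=> [nV' nQ' nS' nG' [E' I' L' hE' hI'] [qs' [[q0' D' F' hD'] K' hK']]].
move=> e; have := can_inj CodeSeq.codeK e; rewrite /=; case=> {e}.
move=> eV eQ eS eG; subst nV' nQ' nS' nG'.
move=> /(pcan_inj pickleK) eE /(pcan_inj pickleK) eI /(pcan_inj pickleK) eL.
move=> /(pcan_inj pickleK) eqs; subst E' I' L' qs'.
move=> /(pcan_inj pickleK) eK /(pcan_inj pickleK) eq0.
move=> /(pcan_inj pickleK) eD /(pcan_inj pickleK) eF; subst K' q0' D' F'.
rewrite (bool_irrelevance hE' hE) (bool_irrelevance hI' hI).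
by rewrite (bool_irrelevance hD' hD) in hK' *; rewrite (bool_irrelevance hK' hK).
Qed.

(* Register (Minsky) machines over unboundedly many registers. [Dec r j]
   jumps to instruction [j] when register [r] is zero, and otherwise decrements
   it and proceeds with the next instruction. A machine halts when the program
   counter leaves the program. *)
Inductive instruction := Inc (r : nat) | Dec (r j : nat).

Definition rm_state : Type := (nat * (nat -> nat))%type.

Definition update (R : nat -> nat) (r v : nat) : nat -> nat :=
  fun r' => if r' == r then v else R r'.

Definition rm_step (p : seq instruction) (s : rm_state) : rm_state :=
  let: (pc, R) := s in
  match onth p pc with
  | None => s
  | Some (Inc r) => (pc.+1, update R r (R r).+1)
  | Some (Dec r j) =>
      if R r == 0 then (j, R) else (pc.+1, update R r (R r).-1)
  end.

(* Input and output are in register 0; the other registers start at 0. *)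
Definition rm_computes (p : seq instruction) (n m : nat) : Prop :=
  exists t, let s := iter t (rm_step p) (0, update (fun=> 0) 0 n) in
    size p <= s.1 /\ s.2 0 = m.

(* The problem [P] restricted to the instances in [D]; the behaviour of the
   machine on codes of other instances is unconstrained. *)
Definition decidable_on (X : Type) (code : X -> nat) (D P : X -> Prop) : Prop :=
  exists p : seq instruction, forall x : X, D x ->
    exists b : bool, rm_computes p (code x) b /\ (b <-> P x).

(* Main.v *)
(* Nonhalting of register machines reduces to model checking, and a decider [p]
   is refuted by diagonalization.

   A universally quantified trace lists the transitions fired by a machine; the
   existentially quantified trace only says when to push and when to pop, so
   that any one-counter automaton can be used on the first trace. The trace is
   rejected iff it is a halting computation: otherwise the automaton guesses
   where it goes wrong, namely in the control flow, in a test of one register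
   (whose value is the stack height, all other registers being ignored), or in
   the number [n] of loading steps that fill the input register. The halting
   letter blocks every run that has not found an error, so that no acceptance
   condition is needed and all states are accepting.

   The input [n] only occurs in the reduction as the length of a chain of states,
   which makes the code of the instance computable from [n] and finitely many
   numbers depending on the machine. These numbers are packed into the input
   itself. The machine computing the code of the instance about itself and its
   own input, running [p] on it and halting iff [p] claims that it does not,
   refutes [p]. *)
From Stdlib Require Import Classical FunctionalExtensionality.
Require Import Defs.
From HB Require Import structures.
From mathcomp Require Import all_boot.
From mathcomp Require Import zify.

Set Implicit Arguments.
Unset Strict Implicit.
Unset Printing Implicit Defensive.

(** * The automaton *)

Inductive action := Nop | Incr of nat | Decr of nat | Zero of nat.

(* [Ctrl j] follows the program counter, [Reg r] keeps the value of register [r]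
   on the stack, [Chain i] has read [i] loading letters. An accepted trace is one
   for which one of them reaches [Sink] or runs forever. *)
Inductive cstate := Sink | Init | Ctrl of nat | Reg of nat | Chain of nat.

Definition cstate_code q :=
  match q with
  | Sink => (0, 0) | Init => (1, 0)
  | Ctrl j => (2, j) | Reg r => (3, r) | Chain i => (4, i)
  end.

Definition cstate_decode c :=
  match c with
  | (0, _) => Sink | (1, _) => Init
  | (2, j) => Ctrl j | (3, r) => Reg r | (_, i) => Chain i
  end.

Lemma cstate_codeK : cancel cstate_code cstate_decode.
Proof. by case. Qed.

HB.instance Definition _ := Equality.copy cstate (can_type cstate_codeK).

(* State, whether the stack is nonempty, letters of the two traces, next state. *)
Definition edge := (cstate * bool * nat * nat * cstate)%type.

(* The letter [y] of the second trace is 1 for a call and 2 for a return. *)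
Definition push_pop (y m : nat) : nat :=
  match y with 1 => m.+1 | 2 => m.-1 | _ => m end.

Definition stack_kind (y : nat) : letter_kind :=
  match y with 1 => Call | 2 => Return | _ => Skip end.

Definition top_symbol (X : bool) : option 'I_1 := if X then Some ord0 else None.

Definition stack_op (X : bool) (y : nat) : seq (option 'I_1) :=
  match y with
  | 1 => [:: top_symbol X; Some ord0]
  | 2 => if X then [::] else [:: None]
  | _ => [:: top_symbol X]
  end.

Definition stack (m : nat) : seq (option 'I_1) := None :: nseq m (Some ord0).

Lemma stackS m : stack m.+1 = rcons (stack m) (Some ord0).
Proof. by rewrite /stack rcons_cons; congr cons; elim: m => //= m <-. Qed.

(** The top symbol of a unary stack only tells whether the height is zero, so the automaton is a
    one-counter automaton with zero test. A return at height zero leaves the stack unchanged, just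
    as [m.-1] does. *)
Lemma stack_rcons m s X : stack m = rcons s X ->
  exists2 b, X = top_symbol b & b = (0 < m) /\
    forall y, s ++ stack_op b y = stack (push_pop y m).
Proof.
case: m => [|m].
  case: s => [|a [|b s]] //= [<-]; exists false => //; split=> //.
  by case=> [|[|[|]]].
rewrite stackS => /rcons_inj[<- <-]; exists true => //; split=> //.
case=> [|[|[|y]]]; rewrite /push_pop ?cats0 ?stackS //=.
- by rewrite -!cats1.
- by rewrite -!cats1 -!catA.
- by rewrite -!cats1.
Qed.

Section Reduction.

Variables (P : seq instruction) (B n : nat).

(* No [Ctrl] state has this source, so that reading it is an error. *)
Definition junk : nat * action * nat := ((size P).+1, Nop, (size P).+1).

(* Source, action and target of a letter. Program counters are shifted by one:
   0 is the loading phase, left through letter 1, and [2 * pc.+1 + b] executes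
   instruction [pc], with [b] the outcome of a test. *)
Definition letter (x : nat) : nat * action * nat :=
  match x with
  | 0 => (0, Incr 0, 0)
  | 1 => (0, Nop, 1)
  | _ =>
    match onth P x./2.-1 with
    | Some (Inc r) => if odd x then junk else (x./2, Incr r, x./2.+1)
    | Some (Dec r j) =>
        if odd x then (x./2, Decr r, x./2.+1) else (x./2, Zero r, j.+1)
    | None => junk
    end
  end.

(** The surplus over the instruction letters is harmless, being read as [junk], and provides the
    stack letters 0, 1 and 2 even for an empty program. *)
Definition last_letter := (size P).+1.*2.+1.
Definition base := B.*2.+2.
Definition last_state := base + n.

(** The chain comes last and is contiguous, so that [n] affects how many states there are but not
    the number of any state. *)
Definition num (q : cstate) : nat :=
  match q with
  | Sink => 0 | Init => 1
  | Ctrl j => j.*2.+2 | Reg r => r.*2.+3 | Chain i => base + i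
  end.

Definition good q :=
  match q with
  | Ctrl j => j < B | Reg r => r < B | Chain i => i <= n | _ => true
  end.

Lemma num_inj : {in good &, injective num}.
Proof.
by move=> [||j|r|i] [||j'|r'|i']; rewrite !unfold_in /= /base => h h' e;
  first [done | congr Ctrl; lia | congr Reg; lia | congr Chain; lia | lia].
Qed.

Lemma num_le q : good q -> num q <= last_state.
Proof. by case: q => [||j|r|i] /=; rewrite /last_state /base; lia. Qed.

(** A move pairs the letter required on the second trace with the next state. [Sink] is entered on
    an error. The empty list blocks, in particular when the shifted target [t] lies beyond the
    program, that is, on a halting letter. *)
Definition fixed_moves q (X : bool) x : seq (nat * cstate) :=
  let: (s, a, t) := letter x in
  let live y := if size P < t then [::] else [:: (y, q)] in
  match q with
  | Sink => [:: (0, Sink)]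
  | Init =>
      if X then [::]
      else [:: (0, Ctrl 0), (0, Chain 0) & [seq (0, Reg r) | r <- iota 0 B]]
  | Ctrl j =>
      if X then [::] else if s != j then [:: (0, Sink)]
      else if size P < t then [::] else [:: (0, Ctrl t)]
  | Reg r =>
      match a with
      | Nop => live 0
      | Incr r' => live (r' == r : nat)
      | Decr r' =>
          if r' != r then live 0 else if X then live 2 else [:: (0, Sink)]
      | Zero r' =>
          if r' != r then live 0 else if X then [:: (0, Sink)] else live 0
      end
  | Chain i => [::]
  end.

(** The two errors are a start letter after fewer than [n] loads and a load after [n] of them.
    Letters from 2 on block here, since [Ctrl 0] detects them during loading. *)
Definition chain_moves i (X : bool) x : seq (nat * cstate) :=
  if X then [::] else
  match x with
  | 0 => [:: (0, if i < n then Chain i.+1 else Sink)]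
  | 1 => if i < n then [:: (0, Sink)] else [::]
  | _ => [::]
  end.

Definition moves q X x :=
  if q is Chain i then chain_moves i X x else fixed_moves q X x.

Definition fixed_states : seq cstate :=
  [:: Sink; Init] ++ [seq Ctrl j | j <- iota 0 B] ++ [seq Reg r | r <- iota 0 B].

Definition fixed_edges : seq edge :=
  [seq (u.1.1, u.1.2, u.2, v.1, v.2) |
    u <- [seq (qX, x) |
           qX <- [seq (q, X) | q <- fixed_states, X <- [:: true; false]],
           x <- iota 0 last_letter.+1],
    v <- fixed_moves u.1.1 u.1.2 u.2].

(** The moves of [chain_moves] are listed separately because only they vary with [n]. *)
Definition load_edge i : edge := (Chain i, false, 0, 0, Chain i.+1).
Definition short_edge i : edge := (Chain i, false, 1, 0, Sink).
Definition long_edge : edge := (Chain n, false, 0, 0, Sink).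

End Reduction.

(* The accumulator mirrors the loop of the program that computes the code. *)
Fixpoint chain_edges n (L : seq edge) : seq edge :=
  if n is i.+1 then chain_edges i [:: load_edge i, short_edge i & L] else L.

Lemma mem_chain_edges n L t : reflect
  (t \in L \/ exists2 i, i < n & t = load_edge i \/ t = short_edge i)
  (t \in chain_edges n L).
Proof.
elim: n L => [|n IH] L /=.
  by apply: (iffP idP) => [|[//|[]//]]; left.
apply: (iffP (IH _)); rewrite !inE.
- case=> [/or3P[/eqP-> | /eqP-> |]|[i lti e]]; [right|right|left=>//|right].
  + by exists n => //; left.
  + by exists n => //; right.
  + by exists i => //; apply: ltnW.
- case=> [->|[i]]; first by left; rewrite !orbT.
  rewrite ltnS leq_eqVlt => /orP[/eqP-> [->|->]|lti e]; rewrite ?eqxx ?orbT; try by left.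
  by right; exists i.
Qed.

Section Automaton.

Variables (P : seq instruction) (B n : nat).

Definition edges := chain_edges n (long_edge n :: fixed_edges P B).

Lemma mem_fixed_states q : (q \in fixed_states B) =
  good B 0 q && (if q is Chain _ then false else true).
Proof.
rewrite /fixed_states /= !inE mem_cat.
case: q => [||j|r|i] //=; rewrite ?andbT ?andbF.
- have -> : Ctrl j \in [seq Reg r | r <- iota 0 B] = false.
    by apply/negP => /mapP[].
  rewrite orbF mem_map; last by move=> ? ? [].
  by rewrite mem_iota.
- have -> : Reg r \in [seq Ctrl j | j <- iota 0 B] = false.
    by apply/negP => /mapP[].
  by rewrite mem_map ?mem_iota // => ? ? [].
- by apply/negP => /orP[] /mapP[].
Qed.

(** The shape of the list [edges] serves the coding; for the semantics it is replaced here by the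
    function [moves]. *)
Lemma mem_edges q X x y q' :
  ((q, X, x, y, q') \in edges) =
  [&& good B n q, x <= last_letter P & (y, q') \in moves P B n q X x].
Proof.
apply/mem_chain_edges/and3P.
- case=> [|[i lti [[-> -> -> -> ->]|[-> -> -> -> ->]]]].
  + rewrite inE => /orP[/eqP[-> -> -> -> ->]|].
      by rewrite /= leqnn /= /moves /chain_moves ltnn inE.
    case/allpairsPdep => [[[q0 X0] x0] [[y0 q0'] []]].
    case/allpairsPdep => [[q1 X1] [x1 []]].
    case/allpairsPdep => [q2 [X2 []]].
    rewrite mem_fixed_states => hq hX [-> ->]; rewrite mem_iota add0n ltnS /= => hx.
    case=> -> -> -> /= hm [-> -> -> -> ->]; split=> //.
      by case: {hm} q2 hq => //= [j|r|i]; rewrite ?andbT ?andbF.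
    by case: q2 hq hm => //= i; rewrite andbF.
  + by rewrite /= /moves /chain_moves ltnW //= lti inE.
  + by rewrite /= /moves /chain_moves ltnW //= lti inE.
- case=> hq hx; case eq : q hq => [||j|r|i] hq hm; last first.
    move: hm; rewrite /= /chain_moves; case: X => //; case: x {hx} => [|[|//]].
      rewrite inE => /eqP[-> ->]; case: ltnP => h; last first.
        left; rewrite inE; have -> : i = n by move: hq => /=; lia.
        by rewrite eqxx.
      by right; exists i => //; left.
    by case: ltnP => // h; rewrite inE => /eqP[-> ->]; right; exists i => //; right.
all: left; rewrite inE; apply/orP; right; apply/allpairsPdep.
all: exists (q, X, x), (y, q'); rewrite eq; split=> //.
all: apply/allpairsPdep; exists (q, X), x; rewrite mem_iota add0n ltnS eq; split=> //.
all: apply/allpairsPdep; eexists; exists X; split; last by [].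
all: rewrite ?mem_fixed_states ?andbT //=.
all: by case: X {hm}; rewrite !inE.
Qed.

Local Notation Qt := 'I_(last_state B n).+1.
Local Notation St := 'I_(last_letter P).+1.

Definition edge_transition (t : edge) : transition Qt (2.-tuple St) 'I_1 :=
  let: (q, X, x, y, q') := t in
  (inord (num B q), top_symbol X, Some [tuple inord x; inord y],
   inord (num B q'), stack_op X y).

Lemma edges_ok : all (@transition_ok _ _ _) (map edge_transition edges).
Proof.
rewrite all_map; apply/allP => -[[[[q X] x] y] q'] _ /=.
by case: X; case: y => [|[|[|y]]].
Qed.

Definition reduction_pda : omega_pda Qt (2.-tuple St : finType) 'I_1 :=
  OmegaPDA (inord 1) setT edges_ok.

Definition reduction_kind : {ffun (2.-tuple St : finType) -> letter_kind} :=
  [ffun a : 2.-tuple St => stack_kind (tnth a ord_max)].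

Lemma moves_le2 q X x y q' : (y, q') \in moves P B n q X x -> y <= 2.
Proof.
rewrite /moves /fixed_moves /chain_moves; case: (letter P x) => [[s a] t].
case: q => [||j|r|i].
- by rewrite inE => /eqP[-> _].
- by case: X => //; rewrite !inE => /or3P[/eqP[->]|/eqP[->]|/mapP[r _ [->]]].
- by case: X => //; case: ifP => _; [|case: ifP => // _]; rewrite inE => /eqP[-> _].
- case: a => [|r'|r'|r']; repeat case: ifP => // _; rewrite inE => /eqP[-> _] //.
  by case: eqP.
- case: X => //; case: x => [|[|x]] //; try case: ifP => // _; rewrite ?inE // => /eqP[-> _] //.
Qed.

Lemma edges_visible :
  all (visible_transition reduction_kind) (pda_trans reduction_pda).
Proof.
rewrite all_map; apply/allP => -[[[[q X] x] y] q'] /=.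
rewrite mem_edges => /and3P[_ _ /moves_le2 hy].
rewrite ffunE (tnth_nth ord0) /= inordK; last first.
  by rewrite /last_letter; lia.
by case: X; case: y hy => [|[|[|y]]].
Qed.

Definition reduction_vpa : omega_vpa Qt (2.-tuple St : finType) 'I_1 :=
  OmegaVPA edges_visible.

Definition reduction_formula : hypervpa Qt St 'I_1 :=
  @HyperVPA Qt St 'I_1 [:: Forall; Exists] reduction_vpa.

(** A complete graph labelled by the identity, so that both variables range over all words. *)
Definition full_system : transition_system St St.
Proof.
refine (@TransitionSystem St St setT setT [ffun v => v] _ _).
- by apply/forallP => v; apply/existsP; exists v; rewrite inE.
- by apply/set0Pn; exists ord0.
Defined.

Definition reduction_instance : mc_instance :=
  MCInstance full_system reduction_formula.

(** The kind of a letter is read off its last component, which belongs to the existential trace. *)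
Lemma reduction_in_class :
  Pi_controlled_class 2 2 (mc_formula reduction_instance).
Proof.
split; first by [].
move=> a b h; rewrite /= !ffunE h // inE.
by rewrite /alternations.
Qed.

Lemma full_trace (w : word St) : trace full_system w.
Proof. by exists w; split=> [|k|k]; rewrite ?inE ?ffunE. Qed.

Definition merge2 (w w' : word St) : word (2.-tuple St) :=
  fun k => [tuple w k; w' k].

Lemma models_reduction :
  models (mc_system reduction_instance) (mc_formula reduction_instance) <->
  forall w, exists w', pda_lang reduction_pda (merge2 w w').
Proof.
have eqm w w' : merge_words [tuple w; w'] = merge2 w w'.
  by apply: functional_extensionality => k; apply: val_inj.
rewrite /models /=; split=> h w.
  have [w' _] := h w (full_trace w).
  rewrite (_ : [tuple of _] = [tuple w; w']) ?eqm; last exact: val_inj.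
  by exists w'.
move=> _; have [w' hw'] := h w; exists w'; first exact: full_trace.
rewrite (_ : [tuple of _] = [tuple w; w']) ?eqm //; exact: val_inj.
Qed.

End Automaton.

(** * Runs of the automaton *)

Section Runs.

Variables (P : seq instruction) (B n : nat).
Hypothesis sizeB : size P < B.

Local Notation St := 'I_(last_letter P).+1.

Definition conf (c : cstate * nat) : config 'I_(last_state B n).+1 'I_1 :=
  (inord (num B c.1), stack c.2).

Lemma pda_stepI q m (x y : St) q' :
  good B n q -> (nat_of_ord y, q') \in moves P B n q (0 < m) x ->
  pda_step (reduction_pda P B n) (conf (q, m)) (Some [tuple x; y])
    (conf (q', push_pop y m)).
Proof.
move=> gq h; exists (inord (num B q)), (top_symbol (0 < m)), (inord (num B q')).
exists (stack_op (0 < m) y), (if m is m'.+1 then stack m' else [::]).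
have e : stack m = rcons (if m is m'.+1 then stack m' else [::]) (top_symbol (0 < m)).
  by case: (m) => // m'; rewrite stackS.
split.
- apply/mapP; exists (q, 0 < m, nat_of_ord x, nat_of_ord y, q'); last first.
    by rewrite /= !inord_val.
  by rewrite mem_edges gq h -ltnS ltn_ord.
- by rewrite -e.
- rewrite /conf /=; congr pair.
  by have [b _ [-> hs]] := stack_rcons e; rewrite hs.
Qed.

(** The source state is recovered from its number because [num] is injective on good states and
    stays within the range of [inord]. *)
Lemma pda_stepE q m a c' :
  good B n q -> pda_step (reduction_pda P B n) (conf (q, m)) a c' ->
  exists (x y : St) q', [/\ a = Some [tuple x; y],
    (nat_of_ord y, q') \in moves P B n q (0 < m) x
    & c' = conf (q', push_pop y m)].
Proof.
move=> gq [q1 [X [q1' [g [s [/mapP[[[[[q0 b] x] y] q'] he [-> eX -> -> ->]] [eq es] ->]]]]]].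
move: he; rewrite mem_edges => /and3P[gq0 hx hm].
have hy := moves_le2 hm.
have eq0 : q = q0.
  apply: (@num_inj B n) => //.
  have := congr1 (@nat_of_ord _) eq; rewrite /= !inordK // ltnS.
    exact: num_le.
  exact: num_le.
subst q0; exists (inord x), (inord y), q'.
rewrite !inordK ?ltnS //; last by rewrite /last_letter; lia.
have [b' eb [eb' hs]] := stack_rcons es.
have ebb : b = b' by move: eb; rewrite eX; case: (b) (b') => [] [].
by subst b b'; split=> //; rewrite /conf /= hs.
Qed.

(** Only the first move is followed, which loses nothing outside [Init], by [moves_det]. *)
Definition succ (x : nat) (c : cstate * nat) : option (nat * (cstate * nat)) :=
  if moves P B n c.1 (0 < c.2) x is (y, q') :: _ then
    Some (y, (q', push_pop y c.2))
  else None.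

Fixpoint run (w : nat -> nat) (q : cstate) (t : nat) : option (cstate * nat) :=
  if t is t'.+1 then omap snd (obind (succ (w t')) (run w q t'))
  else Some (q, 0).

Definition starts := [:: Ctrl 0, Chain 0 & [seq Reg r | r <- iota 0 B]].

Lemma starts_good q : q \in starts -> good B n q && (q != Init).
Proof.
rewrite !inE => /or3P[/eqP->|/eqP->|/mapP[r]] //=; first by rewrite (leq_trans _ sizeB).
by rewrite mem_iota => hr -> /=; rewrite andbT.
Qed.

Lemma moves_det q X x y q' : q != Init ->
  (y, q') \in moves P B n q X x -> moves P B n q X x = [:: (y, q')].
Proof.
rewrite /moves /fixed_moves /chain_moves; case: (letter P x) => [[s a] t].
case: q => [||j|r|i] // _.
- by rewrite inE => /eqP<-.
- by repeat case: ifP => // _; rewrite inE => /eqP<-.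
- by case: a => [|r'|r'|r']; repeat case: ifP => // _; rewrite inE => /eqP<-.
- by case: X => //; case: x => [|[|x]] //; repeat case: ifP => // _; rewrite inE => /eqP<-.
Qed.

Lemma moves_good q X x y q' : good B n q -> (y, q') \in moves P B n q X x ->
  good B n q' && (q' != Init).
Proof.
rewrite /moves /fixed_moves /chain_moves; case: (letter P x) => [[s a] t].
case: q => [||j|r|i] gq.
- by rewrite inE => /eqP[_ ->].
- case: X => // h; apply: starts_good; move: h; rewrite !inE.
  by case/or3P => [/eqP[_ ->]|/eqP[_ ->]|/mapP[r hr [_ ->]]] //; rewrite map_f ?orbT.
- case: X => //; case: ifP => _; first by rewrite inE => /eqP[_ ->].
  case: ltnP => // ht; rewrite inE => /eqP[_ ->] /=.
  by rewrite (leq_ltn_trans ht).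
- by case: a => [|r'|r'|r']; repeat case: ifP => // _; rewrite inE => /eqP[_ ->]; rewrite ?gq.
- case: X => //; case: x => [|[|x]] //; case: ifP => // h; rewrite inE => /eqP[_ ->] //.
  by rewrite /= h.
Qed.

(* The initial state ignores the first letter and guesses one of [starts]; the
   rest of the run is deterministic. *)
Definition tail (w : word St) (t : nat) : nat := w t.+1.

Lemma reads_total (S : Type) (l : nat -> option S) (v w : word S) :
  (forall i, l i = Some (v i)) -> reads l w -> forall i, v i = w i.
Proof.
move=> hl hr i; have [k hk] := hr i.+1.
have e : mkseq l k = map Some (mkseq v k).
  by rewrite /mkseq -map_comp; apply: eq_map => j /=.
move: hk; rewrite e (map_pK (g := Some)) // => hk.
have ek : k = i.+1 by have := congr1 size hk; rewrite !size_mkseq.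
by have := congr1 (nth (v 0) ^~ i) hk; rewrite ek !nth_mkseq.
Qed.

Lemma accepted_run w w' : pda_lang (reduction_pda P B n) (merge2 w w') ->
  exists2 q, q \in starts & forall t, run (tail w) q t <> None.
Proof.
case=> c [l [c0 hstep hreads _]].
have inv i : exists q m, good B n q /\ c i = conf (q, m).
  elim: i => [|i [q [m [gq e]]]]; first by exists Init, 0.
  have := hstep i; rewrite e => /pda_stepE -/(_ gq) [x [y [q' [_ hm ->]]]].
  by have /andP[gq' _] := moves_good gq hm; exists q', (push_pop y m).
have label i : exists v, l i = Some v.
  have [q [m [gq e]]] := inv i.
  have := hstep i; rewrite e => /pda_stepE -/(_ gq) [x [y [q' [-> _ _]]]].
  by exists [tuple x; y].
have hl i : l i = Some (merge2 w w' i).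
  pose v j := odflt (merge2 w w' 0) (l j).
  have hv j : l j = Some (v j) by rewrite /v; have [u ->] := label j.
  by rewrite hv (reads_total hv hreads).
have st i q m : good B n q -> c i = conf (q, m) -> exists q',
    [/\ (nat_of_ord (w' i), q') \in moves P B n q (0 < m) (w i),
        good B n q', q' != Init & c i.+1 = conf (q', push_pop (w' i) m)].
  move=> gq e; have := hstep i; rewrite e hl => /pda_stepE -/(_ gq).
  case=> x [y [q' [[ex ey] hm ->]]]; exists q'; rewrite ex ey.
  by have /andP[gq' nq'] := moves_good gq hm.
have [q [hm gq nq e1]] : exists q',
    [/\ (nat_of_ord (w' 0), q') \in moves P B n Init false (w 0),
        good B n q', q' != Init & c 1 = conf (q', push_pop (w' 0) 0)].
  by apply: (st 0 Init 0).
(* The moves out of [Init] carry the stack letter 0, so the deterministic part starts on the empty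
   stack, as [run] does. *)
have [y0 hq] : push_pop (w' 0) 0 = 0 /\ q \in starts.
  move: hm; rewrite /= /fixed_moves; case: letter => [[? ?] ?]; rewrite !inE.
  by case/or3P => [/eqP[-> ->]|/eqP[-> ->]|/mapP[r hr [-> ->]]] //; rewrite map_f ?orbT.
exists q => // t.
suff [q1 [m1 [e _ _ _]]] : exists q1 m1, [/\ run (tail w) q t = Some (q1, m1),
  good B n q1, q1 != Init & c t.+1 = conf (q1, m1)] by rewrite e.
elim: t => [|t [q1 [m1 [e g1 n1 ec]]]].
  by exists q, 0; rewrite e1 y0.
have [q2 [hm2 g2 n2 e2]] := st _ _ _ g1 ec.
exists q2, (push_pop (w' t.+1) m1); split=> //=.
by rewrite e /= /succ /= (moves_det n1 hm2).
Qed.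

Lemma run_accepted w q : q \in starts ->
  (forall t, run (tail w) q t <> None) ->
  exists w', pda_lang (reduction_pda P B n) (merge2 w w').
Proof.
move=> hq hrun.
pose s t := odflt (q, 0) (run (tail w) q t).
have hs t : run (tail w) q t = Some (s t).
  by rewrite /s; case: run (hrun t).
have hsucc t : exists y, succ (w t.+1) (s t) = Some (y, s t.+1).
  have := hs t.+1; rewrite /= hs /= /tail; case: succ => //= -[y c] [->].
  by exists y.
pose ctl t := if succ (w t.+1) (s t) is Some (y, _) then y else 0.
have hm t : (ctl t, (s t.+1).1) \in moves P B n (s t).1 (0 < (s t).2) (w t.+1) /\
    (s t.+1).2 = push_pop (ctl t) (s t).2.
  have [y] := hsucc t; rewrite /ctl /succ.
  by case: moves => // -[y' q'] mv [-> <-]; rewrite inE eqxx.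
have gs t : good B n (s t).1.
  elim: t => [|t IH]; last by have [/moves_good -/(_ IH)/andP[]] := hm t.
  by rewrite /s /=; have /andP[] := starts_good hq.
(* The existential trace spells out the stack letters demanded by the run; its first letter 0
   matches the move out of [Init]. *)
pose w' t : St := if t is t'.+1 then inord (ctl t') else ord0.
exists w', (fun t => if t is t'.+1 then conf (s t') else conf (Init, 0)).
exists (fun t => Some (merge2 w w' t)); split.
- by [].
- case=> [|t].
    rewrite /merge2 /s /=; apply: pda_stepI => //.
    rewrite /= /fixed_moves; case: letter => [[? ?] ?].
    move: hq; rewrite !inE => /or3P[/eqP->|/eqP->|/mapP[r hr ->]]; rewrite ?eqxx ?orbT //.
    by apply/or3P/Or33; apply: map_f.
  have [h1 h2] := hm t; have := moves_le2 h1 => hy.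
  have ew : nat_of_ord (w' t.+1) = ctl t by rewrite /= inordK // /last_letter; lia.
  have -> : conf (s t.+1) = conf ((s t.+1).1, push_pop (w' t.+1) (s t).2).
    by rewrite ew -h2 -surjective_pairing.
  have -> : conf (s t) = conf ((s t).1, (s t).2) by rewrite -surjective_pairing.
  by apply: pda_stepI; rewrite ?ew.
- move=> k; exists k.
  rewrite (_ : mkseq _ k = map Some (mkseq (merge2 w w') k)).
    by rewrite (map_pK (g := Some)).
  by rewrite /mkseq -map_comp; apply: eq_map.
- by move=> k; exists k => //; rewrite inE.
Qed.

Lemma models_reduction_run :
  models (mc_system (reduction_instance P B n))
         (mc_formula (reduction_instance P B n)) <->
  forall w : word St, exists2 q, q \in starts &
    forall t, run (tail w) q t <> None.
Proof.
rewrite models_reduction; split=> h w; have := h w.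
  by case=> w' /accepted_run.
by case=> q hq hr; apply: (run_accepted hq hr).
Qed.

End Runs.

(** * Correctness of the reduction: surviving runs against halting computations *)

Definition rm_input (n : nat) : rm_state := (0, update (fun=> 0) 0 n).

Definition halts (P : seq instruction) (n : nat) : Prop :=
  exists t, size P <= (iter t (rm_step P) (rm_input n)).1.

Definition instr_reg (i : instruction) : nat :=
  match i with Inc r => r | Dec r _ => r end.

Lemma all_onth (T : Type) (a : pred T) s i x :
  all a s -> onth s i = Some x -> a x.
Proof. by elim: s i => [|y s IH] [|i] //= /andP[hy hs]; [case=> <-|apply: IH]. Qed.

Section Correctness.

Variables (P : seq instruction) (B n : nat).
Hypothesis sizeB : size P < B.
Hypothesis regB : all (fun i => instr_reg i < B) P.

Definition rm_trace (t : nat) : rm_state := iter t (rm_step P) (rm_input n).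

(* Configuration after [t] correct letters: [n] loading steps, the start letter,
   then the computation of the machine. *)
Definition loading (t : nat) : rm_state :=
  if t <= n then rm_input t
  else ((rm_trace (t - n.+1)).1.+1, (rm_trace (t - n.+1)).2).

Definition instr_letter (s : rm_state) : nat :=
  match onth P s.1 with
  | Some (Dec r _) => if s.2 r == 0 then s.1.+1.*2 else s.1.+1.*2.+1
  | Some (Inc _) => s.1.+1.*2
  | None => 0
  end.

Definition right_letter (t : nat) : nat :=
  if t < n then 0 else if t == n then 1 else instr_letter (rm_trace (t - n.+1)).

Definition fires (x : nat) (s s' : rm_state) : Prop :=
  [/\ (letter P x).1.1 = s.1, (letter P x).2 = s'.1 &
  match (letter P x).1.2 with
  | Nop => s'.2 = s.2
  | Incr r => s'.2 = update s.2 r (s.2 r).+1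
  | Decr r => 0 < s.2 r /\ s'.2 = update s.2 r (s.2 r).-1
  | Zero r => s.2 r = 0 /\ s'.2 = s.2
  end].

Lemma updateK R r v v' : update (update R r v) r v' = update R r v'.
Proof. by apply: functional_extensionality => k; rewrite /update; case: eqP. Qed.

Lemma onth_some (T : Type) (s : seq T) i : i < size s -> {x | onth s i = Some x}.
Proof. by rewrite -onthTE; case: onth => // x _; exists x. Qed.

Lemma letterD pc (b : bool) : letter P (b + pc.+1.*2) =
  match onth P pc with
  | Some (Inc r) => if b then junk P else (pc.+1, Incr r, pc.+2)
  | Some (Dec r j) => if b then (pc.+1, Decr r, pc.+2) else (pc.+1, Zero r, j.+1)
  | None => junk P
  end.
Proof.
have eh : (b + pc.+1.*2)./2 = pc.+1 by rewrite half_bit_double.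
have eo : odd (b + pc.+1.*2) = b by rewrite oddD odd_double addbF oddb.
have [x ex] : exists x, b + pc.+1.*2 = x.+2 by exists (b + pc.*2); lia.
by move: eh eo; rewrite ex /letter => -> ->.
Qed.

(** With program counters shifted by one, the hypothesis says that the machine has not halted
    yet. *)
Lemma right_fires t : (loading t).1 <= size P ->
  fires (right_letter t) (loading t) (loading t.+1).
Proof.
rewrite /loading /right_letter /fires; case: (ltngtP t n) => [lt|gt|->].
- by rewrite /= updateK.
- rewrite subSS => hs.
  have -> : t - n = (t - n.+1).+1 by lia.
  rewrite /rm_trace iterS -/(rm_trace _).
  case: (rm_trace (t - n.+1)) hs => pc R /= hs.
  have [i hi] := onth_some hs; rewrite /instr_letter /= hi.
  case: i hi => [r|r j] hi.
    by have := letterD pc false; rewrite hi add0n => ->.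
  case: eqP => hr.
    by have := letterD pc false; rewrite hi add0n => ->.
  by have := letterD pc true; rewrite hi add1n => -> /=; split=> //; split=> //; lia.
- by rewrite /= subnn.
Qed.

Lemma right_letter_le t : right_letter t <= last_letter P.
Proof.
rewrite /right_letter /last_letter; case: ifP => // _; case: ifP => [_|_]; first by lia.
rewrite /instr_letter; case: (rm_trace _) => pc R /=.
have := onthTE P pc; case: (onth P pc) => [[r|r j]|] //= /esym h; first by lia.
by case: ifP; lia.
Qed.

Lemma succ_fires x s s' : fires x s s' -> s'.1 <= size P ->
  omap snd (succ P B n x (Ctrl s.1, 0)) = Some (Ctrl s'.1, 0) /\
  forall r, omap snd (succ P B n x (Reg r, s.2 r)) = Some (Reg r, s'.2 r).
Proof.
rewrite /fires /succ /= /fixed_moves; case: letter => [[src a] t] /= [-> -> ha].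
move=> ht; rewrite eqxx ltnNge ht /=; split=> // r.
case: a ha => [->|r' ->|r' [h ->]|r' [h ->]] //=; rewrite ?/update 1?[r == _]eq_sym;
  case: eqP => //= e; subst r'; by rewrite ?h.
Qed.

(** A correct halting letter exhibits no error, so the control run and every register run block on
    it. *)
Lemma succ_halts x s s' : fires x s s' -> size P < s'.1 ->
  succ P B n x (Ctrl s.1, 0) = None /\
  forall r, succ P B n x (Reg r, s.2 r) = None.
Proof.
rewrite /fires /succ /= /fixed_moves; case: letter => [[src a] t] /= [-> -> ha].
move=> ht; rewrite eqxx ht /=; split=> // r.
case: a ha => [_|r' _|r' [h _]|r' [h _]] //=; case: eqP => //= e; subst r'; by rewrite h.
Qed.

(** A wrong letter with the wrong source is caught by the control run. One with the right source
    either claims the wrong outcome of a test, caught by the run of the tested register, or confuses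
    load and start, caught by the chain. *)
Lemma succ_wrong x t : (loading t).1 <= size P -> x <> right_letter t ->
  [\/ omap snd (succ P B n x (Ctrl (loading t).1, 0)) = Some (Sink, 0),
      exists2 r, r < B &
        exists m, omap snd (succ P B n x (Reg r, (loading t).2 r)) = Some (Sink, m)
    | t <= n /\ omap snd (succ P B n x (Chain t, 0)) = Some (Sink, 0)].
Proof.
rewrite /loading /right_letter.
have small t' : x > 1 -> omap snd (succ P B n x (Ctrl (rm_input t').1, 0)) = Some (Sink, 0).
  move=> x1; rewrite /succ /= /fixed_moves.
  suff : (letter P x).1.1 != 0 by case: letter => [[s a] u] /= ->.
  case: x x1 => [|[|x]] // _; rewrite /letter.
  by case: onth => [[r|r j]|] //; case: ifP.
case: (ltngtP t n) => [lt _|gt|->].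
- case: x small => [//|[_ _|x small _]]; last by apply: Or31; apply: small.
  by apply: Or33; split; rewrite ?(ltnW lt) // /succ /= lt.
- case: (rm_trace _) => pc R /= hs hx.
  have [i hi] := onth_some hs.
  have [/eqP e|ne] := boolP ((letter P x).1.1 == pc.+1); last first.
    apply: Or31; rewrite /succ /= /fixed_moves.
    by case: letter ne => [[s a] u] /= ->.
  (* The right source leaves only the two letters of instruction [pc]. For an [Inc], the odd one is
     [junk] and the even one is correct, so a test remains. *)
  have [b ex] : exists b : bool, x = b + pc.+1.*2.
    exists (odd x); suff -> : pc.+1 = x./2 by rewrite odd_double_half.
    move: e hs; rewrite /letter; case: (x) => [|[|x']] //.
    by case: onth => [[r|r j]|] /=; try case: ifP => _ /=; rewrite ?/junk /=; lia.
  subst x; move: e hx; rewrite letterD /instr_letter /= hi.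
  case: i hi => [r|r j] hi.
    by case: b small => /= _; [lia | rewrite add0n].
  move=> _ hx; apply: Or32; exists r.
    exact: (all_onth regB hi).
  rewrite /succ /= /fixed_moves letterD hi.
  case: b small hx => /= _; rewrite eqxx /=; case: (R r) => [|m] //= _; eexists; reflexivity.
- move=> _; case: x small => [_ _|[//|x small _]].
    by apply: Or33; rewrite /succ /= ltnn.
  by apply: Or31; apply: small.
Qed.

Lemma run_sink w q t m k : run P B n w q t = Some (Sink, m) ->
  run P B n w q (k + t) = Some (Sink, m).
Proof.
move=> h; elim: k => [//|k IH]; rewrite addSn /= IH /= /succ /= /fixed_moves.
by case: letter => [[s a] u].
Qed.

Lemma run_none w q t k : run P B n w q t = None -> run P B n w q (k + t) = None.
Proof. by move=> h; elim: k => [//|k IH]; rewrite addSn /= IH. Qed.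

Lemma sink_lives w q t m : run P B n w q t = Some (Sink, m) ->
  forall u, run P B n w q u <> None.
Proof.
move=> h u; have [le|/ltnW le] := leqP t u.
  by rewrite -(subnK le) (run_sink _ h).
by move=> /(@run_none _ _ _ (t - u)); rewrite subnK // h.
Qed.

Lemma run_right (w : nat -> nat) t :
  (forall u, u < t -> w u = right_letter u /\ (loading u.+1).1 <= size P) ->
  [/\ (loading t).1 <= size P,
      run P B n w (Ctrl 0) t = Some (Ctrl (loading t).1, 0),
      forall r, run P B n w (Reg r) t = Some (Reg r, (loading t).2 r)
    & t <= n -> run P B n w (Chain 0) t = Some (Chain t, 0)].
Proof.
elim: t => [|t IH] h.
  split=> // r; rewrite /loading /= /update; case: eqP => //.
have [//|h0 h1 h2 h3] := IH _.
  by move=> u ut; apply: h; apply: ltnW.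
have [ew hs] := h t (ltnSn t).
have [h4 h5] := succ_fires (right_fires h0) hs.
split=> //=.
- by rewrite h1 /= ew h4.
- by move=> r; rewrite h2 /= ew h5.
- by move=> lt; rewrite h3 1?ltnW //= ew /right_letter lt /succ /= lt.
Qed.

Lemma models_reduction_halts :
  models (mc_system (reduction_instance P B n))
         (mc_formula (reduction_instance P B n)) <-> ~ halts P n.
Proof.
rewrite models_reduction_run //; split.
- move=> h [T hT].
  have [k hk] : exists k, size P < (loading k.+1).1.
    exists (n + T); rewrite /loading (_ : ((n + T).+1 <= n) = false); last by lia.
    by rewrite /= subSS addKn ltnS.
  case: (ex_minnP (ex_intro (fun k => size P < (loading k.+1).1) k hk)) => {hk}k hk kmin.
  (* This word lists the halting computation up to its first halting letter, at [k]. Its own first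
     letter is arbitrary, as [Init] ignores it. *)
  pose w t : 'I_(last_letter P).+1 := if t is t'.+1 then inord (right_letter t') else ord0.
  have hw u : tail w u = right_letter u by rewrite /tail /= inordK // ltnS right_letter_le.
  have [|h0 h1 h2 _] := @run_right (tail w) k.
    move=> u uk; split=> //; rewrite leqNgt; apply/negP => /kmin; lia.
  have [h4 h5] := succ_halts (right_fires h0) hk.
  have [q] := h w; rewrite !inE => /or3P[/eqP->|/eqP->|/mapP[r _ ->]].
  + by move/(_ k.+1); rewrite /= h1 /= hw h4.
  (* The chain run blocks earlier, at the start letter, having counted exactly [n] loads. *)
  + have [|_ _ _ h6] := @run_right (tail w) n.
      move=> u un; split=> //.
      by rewrite /loading un /=.
    by move/(_ n.+1); rewrite /= h6 //= hw /right_letter ltnn eqxx /succ /= ltnn.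
  + by move/(_ k.+1); rewrite /= h2 /= hw h5.
- move=> nh w.
  have live t : (loading t).1 <= size P.
    rewrite /loading; case: ifP => // _; rewrite /= ltnNge; apply/negP => h.
    by apply: nh; exists (t - n.+1).
  (* On an entirely correct trace the control run survives because the machine never halts.
     Otherwise the first wrong letter sends one of the guesses to [Sink]. *)
  have [all_right|] := classic (forall t, tail w t = right_letter t).
    exists (Ctrl 0); first by rewrite inE.
    by move=> t; have [|_ -> _ _] := @run_right (tail w) t.
  move=> /not_all_ex_not[k /eqP hk].
  case: (ex_minnP (ex_intro (fun k => tail w k != right_letter k) k hk)) => {hk}k /eqP hk kmin.
  have [|_ h1 h2 h3] := @run_right (tail w) k.
    move=> u uk; split=> //; apply/eqP; apply: contraLR uk => /kmin.
    by rewrite -leqNgt.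
  have [h|[r hr [m h]]|[le h]] := succ_wrong (live k) hk.
  + exists (Ctrl 0); first by rewrite inE.
    by apply: (@sink_lives _ _ k.+1 0); rewrite /= h1 /= h.
  + exists (Reg r).
      by rewrite !inE; apply/orP; right; apply/orP; right; rewrite map_f ?mem_iota.
    by apply: (@sink_lives _ _ k.+1 m); rewrite /= h2 /= h.
  + exists (Chain 0); first by rewrite !inE eqxx orbT.
    by apply: (@sink_lives _ _ k.+1 0); rewrite /= h3 //= h.
Qed.

End Correctness.

(** * The code of an instance *)

Notation code := CodeSeq.code.

(* The code of an edge from [q] to [q'] that leaves the empty stack unchanged;
   [l] codes its letter: 8 for a load, 64 for the start. *)
Definition chain_edge_code (q l q' : nat) : nat :=
  code [:: code [:: code [:: code [:: q; 0]; l]; q']; 1].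

Fixpoint chain_codes (b n : nat) (L : seq nat) : seq nat :=
  if n is i.+1 then
    chain_codes b i [:: chain_edge_code (b + i) 8 (b + i).+1,
                        chain_edge_code (b + i) 64 0 & L]
  else L.

(** Codes of the pairs of [i] and [true]: the graph of the characteristic function of the full set,
    here the set of accepting states. *)
Fixpoint full_codes (m : nat) (L : seq nat) : seq nat :=
  if m is i.+1 then full_codes i (code [:: i; 1] :: L) else L.

Definition transitions_code (b D n : nat) : nat :=
  code (chain_codes b n (chain_edge_code (b + n) 8 0 :: CodeSeq.decode D)).

(** The parameters [s], [b], [D] and [mid] stand for data fixed by the machine, [D] being the packed
    list of codes of the fixed edges. The input [n] enters only through the number of states, the
    chain and the accepting set. *)
Definition system_code (s b D n : nat) (mid : seq nat) : nat :=
  code (s :: (b + n).+1 :: mid ++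
    [:: transitions_code b D n; code (full_codes (b + n).+1 [::])]).

Lemma pickle_seqE (T : countType) (s : seq T) : pickle s = code (map pickle s).
Proof. by []. Qed.

Lemma pickle_setT m : pickle ([set: 'I_m]) = code (full_codes m [::]).
Proof.
transitivity (pickle (tfgraph (val [set: 'I_m]))); first by [].
transitivity (pickle (val (tfgraph (val [set: 'I_m])))); first by [].
rewrite pickle_seqE; congr (code _).
rewrite (_ : \val _ = codom (total_fun (val [set: 'I_m]))); last by [].
rewrite /codom /image_mem -map_comp.
transitivity [seq code [:: i; 1] | i <- map val (enum 'I_m)].
  rewrite -map_comp; apply: eq_map => i; rewrite /= /total_fun /=.
  have -> : val [set: 'I_m] i = true by rewrite /setTfor unlock /= ffunE.
  by [].
rewrite val_enum_ord -[LHS]cats0.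
suff h L : [seq code [:: i; 1] | i <- iota 0 m] ++ L = full_codes m L by exact: h.
elim: m L => [|m IH] L //.
by rewrite -[RHS]/(full_codes m _) -IH -[m.+1]addn1 iotaD map_cat -catA add0n.
Qed.

Section Encode.

Variables (P : seq instruction) (B : nat).

Definition edge_code (t : edge) : nat :=
  let: (q, X, x, y, q') := t in
  code [:: code [:: code [:: code [:: num B q; pickle (top_symbol X)];
    pickle (Some [tuple inord x; inord y] : option (2.-tuple 'I_(last_letter P).+1))];
    num B q']; pickle (stack_op X y)].

Lemma pickle_edge n t :
  t \in edges P B n -> size P < B ->
  pickle (edge_transition P B n t) = edge_code t.
Proof.
case: t => [[[[q X] x] y] q']; rewrite mem_edges => /and3P[gq _ hm] hB.
have /andP[gq' _] := moves_good hB gq hm.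
have e r : good B n r -> pickle (inord (num B r) : 'I_(last_state B n).+1) = num B r.
  by move=> gr; rewrite -[LHS]/(nat_of_ord _) inordK // ltnS num_le.
rewrite /edge_code -(e _ gq) -(e _ gq').
by [].
Qed.

Lemma pickle_letter x : x <= 1 ->
  pickle (Some [tuple inord x; inord 0] : option (2.-tuple 'I_(last_letter P).+1)) =
  code [:: code [:: x; 0]].
Proof.
move=> hx; have h (a b : 'I_(last_letter P).+1) :
  pickle (Some [tuple a; b]) = code [:: code [:: nat_of_ord a; nat_of_ord b]] by [].
by rewrite h !inordK //; rewrite /last_letter; lia.
Qed.

Lemma edges_code n :
  map edge_code (edges P B n) =
  chain_codes (base B) n (chain_edge_code (base B + n) 8 0 ::
                          map edge_code (fixed_edges P B)).
Proof.
rewrite /edges.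
have e1 i : edge_code (load_edge i) =
    chain_edge_code (base B + i) 8 (base B + i).+1.
  by rewrite /edge_code /= pickle_letter //= addnS.
have e2 i : edge_code (short_edge i) = chain_edge_code (base B + i) 64 0.
  by rewrite /edge_code /= pickle_letter.
have -> : chain_edge_code (base B + n) 8 0 :: map edge_code (fixed_edges P B) =
    map edge_code (long_edge n :: fixed_edges P B).
  by rewrite /= pickle_letter.
move: (_ :: _) => L; elim: n L => [//|n IH] L; rewrite /= IH.
by rewrite [in LHS]map_cons map_cons e1 e2.
Qed.

Lemma encode_reduction : size P < B -> exists s D mid, size mid = 8 /\
  forall n, encode (reduction_instance P B n) =
            system_code s (base B) D n mid.
Proof.
move=> hB; exists (last_letter P).+1, (code (map edge_code (fixed_edges P B))).
exists [:: (last_letter P).+1; 1; pickle (ts_edge (full_system P));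
  pickle (ts_init (full_system P)); pickle (ts_label (full_system P));
  pickle [:: Forall; Exists]; pickle (reduction_kind P); num B Init].
split=> // n; rewrite /system_code /transitions_code CodeSeq.codeK -edges_code.
have -> : code (full_codes (base B + n).+1 [::]) =
    pickle (pda_final (reduction_pda P B n)) by rewrite -pickle_setT.
have -> : code (map edge_code (edges P B n)) =
    pickle (pda_trans (reduction_pda P B n)).
  rewrite pickle_seqE; congr code; rewrite -map_comp; apply/esym.
  by apply/eq_in_map => t ht; apply: pickle_edge.
have -> : num B Init = pickle (pda_init (reduction_pda P B n)).
  by rewrite -[RHS]/(nat_of_ord _) inordK.
by [].
Qed.

End Encode.

(** * Structured programs *)

(** Decrements occur only inside tests, as with [Dec]: a loop uses up its counter, and finding a
    register nonzero costs one unit. *)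
Inductive cmd :=
  | Add1 of nat
  | Seq of cmd & cmd
  | For of nat & cmd
  | If of nat & cmd & cmd.

Notation "c1 ;; c2" := (Seq c1 c2) (at level 61, right associativity).

Notation store := (nat -> nat).

(* Register 1 must be zero at unconditional jumps, which are compiled to tests
   of it. *)
Inductive ev : cmd -> store -> store -> Prop :=
  | ev_add1 r R : ev (Add1 r) R (update R r (R r).+1)
  | ev_seq c1 c2 R R1 R2 : ev c1 R R1 -> ev c2 R1 R2 -> ev (c1 ;; c2) R R2
  | ev_for0 r c R : R r = 0 -> ev (For r c) R R
  | ev_forS r c R R1 R2 : 0 < R r -> ev c (update R r (R r).-1) R1 ->
      R1 1 = 0 -> ev (For r c) R1 R2 -> ev (For r c) R R2
  | ev_if0 r c1 c2 R R1 : R r = 0 -> ev c2 R R1 -> ev (If r c1 c2) R R1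
  | ev_ifS r c1 c2 R R1 : 0 < R r -> ev c1 (update R r (R r).-1) R1 ->
      R1 1 = 0 -> ev (If r c1 c2) R R1.

Fixpoint compile (off : nat) (c : cmd) : seq instruction :=
  match c with
  | Add1 r => [:: Inc r]
  | c1 ;; c2 =>
      compile off c1 ++ compile (off + size (compile off c1)) c2
  | For r c1 =>
      let p := compile off.+1 c1 in
      Dec r (off + (size p).+2) :: p ++ [:: Dec 1 off]
  | If r c1 c2 =>
      let p1 := compile off.+1 c1 in
      let p2 := compile (off + (size p1).+2) c2 in
      Dec r (off + (size p1).+2) :: p1 ++
        Dec 1 (off + (size p1).+2 + size p2) :: p2
  end.

Definition reaches (P : seq instruction) (s s' : rm_state) : Prop :=
  exists t, iter t (rm_step P) s = s'.

Lemma reaches_refl P s : reaches P s s.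
Proof. by exists 0. Qed.

Lemma reaches_trans P s1 s2 s3 :
  reaches P s1 s2 -> reaches P s2 s3 -> reaches P s1 s3.
Proof. by move=> [t <-] [t' <-]; exists (t' + t); rewrite iterD. Qed.

Lemma reaches_step P s s' : reaches P (rm_step P s) s' -> reaches P s s'.
Proof. by apply: reaches_trans; exists 1. Qed.

Lemma onth_size (pre post : seq instruction) i :
  onth (pre ++ i :: post) (size pre) = Some i.
Proof. by rewrite onth_cat ltnn subnn. Qed.

(** Jump targets are absolute, so the induction needs arbitrary surrounding code [pre] and
    [post]. *)
Lemma compile_correct c R R' : ev c R R' -> forall pre post,
  reaches (pre ++ compile (size pre) c ++ post) (size pre, R)
    (size pre + size (compile (size pre) c), R').
Proof.
elim=> {c R R'}.
- move=> r R pre post; exists 1 => /=.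
  by rewrite onth_size addn1.
- move=> c1 c2 R R1 R2 _ IH1 _ IH2 pre post /=.
  apply: reaches_trans; first by rewrite -catA; apply: IH1.
  have := IH2 (pre ++ compile (size pre) c1) post.
  by rewrite -!catA !size_cat -addnA.
- move=> r c R h pre post; exists 1 => /=.
  by rewrite onth_size h /= size_cat addn1.
- move=> r c R R1 R2 h _ IH1 h1 _ IH2 pre post.
  apply: reaches_trans (IH2 pre post) => /=.
  apply: reaches_step; rewrite /rm_step /= onth_size.
  rewrite lt0n in h; rewrite (negPf h).
  set d := Dec r _; set p := compile _ c.
  have := IH1 (rcons pre d) ([:: Dec 1 (size pre)] ++ post).
  rewrite size_rcons -/p cat_rcons => h2.
  rewrite -catA; apply: reaches_trans h2 _; exists 1.
  rewrite -cat_rcons [in iter _ _]catA -(size_rcons pre d) -size_cat /=.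
  by rewrite onth_size h1.
- move=> r c1 c2 R R1 h _ IH pre post.
  apply: reaches_step; rewrite /rm_step /= onth_size h /=.
  set p1 := compile _ c1; set off := size pre + _; set p2 := compile _ c2.
  set d := Dec r _; set d1 := Dec 1 _.
  have := IH (pre ++ d :: p1 ++ [:: d1]) post.
  rewrite (_ : size (pre ++ d :: p1 ++ [:: d1]) = off); last first.
    by rewrite !size_cat /= size_cat /= addn1.
  rewrite -!catA cat_cons -!catA -/p2 /=.
  rewrite (_ : size pre + _ = off + size p2) //.
  by rewrite size_cat /= /off; lia.
- move=> r c1 c2 R R1 h _ IH h1 pre post.
  apply: reaches_step; rewrite /rm_step /= onth_size.
  rewrite lt0n in h; rewrite (negPf h).
  set p1 := compile _ c1; set off := size pre + _; set p2 := compile _ c2.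
  set d := Dec r _; set d1 := Dec 1 _.
  have := IH (rcons pre d) (d1 :: p2 ++ post).
  rewrite size_rcons -/p1 cat_rcons => h2.
  rewrite -catA; apply: reaches_trans h2 _; exists 1.
  rewrite -cat_rcons [in iter _ _]catA -(size_rcons pre d) -size_cat /=.
  by rewrite onth_size /d1 h1 /= size_cat /= /off; congr pair; lia.
Qed.

Lemma compile_correct0 c R R' : ev c R R' -> forall post,
  reaches (compile 0 c ++ post) (0, R) (size (compile 0 c), R').
Proof. by move=> h; apply: (compile_correct h [::]). Qed.

(** * Macros for register arithmetic and for lists coded as numbers *)

Lemma ev_eq c R R1 R2 : ev c R R1 -> R1 = R2 -> ev c R R2.
Proof. by move=> h <-. Qed.

Ltac store_eq := apply: functional_extensionality => ?; rewrite /update;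
  repeat (case: eqP => ?); subst; try congruence; try lia.

(** The loop invariant [f k] is the store when [k] rounds remain. *)
Lemma ev_for r c (f : nat -> store) m :
  (forall k, f k r = k) -> (forall k, f k 1 = 0) ->
  (forall k, k < m -> ev c (update (f k.+1) r k) (f k)) ->
  ev (For r c) (f m) (f 0).
Proof.
move=> fr f1; elim: m => [_|m IH h]; first by apply: ev_for0.
apply: ev_forS (f1 m) _; rewrite ?fr //; first by apply: h.
by apply: IH => k km; apply: h; apply: ltnW.
Qed.

Definition move_reg a b := For a (Add1 b).

Lemma ev_move a b R : a <> b -> a <> 1 -> b <> 1 -> R 1 = 0 ->
  ev (move_reg a b) R (update (update R b (R b + R a)) a 0).
Proof.
move=> ab a1 b1 R1.
pose f k := update (update R b (R b + (R a - k))) a k.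
have <- : f 0 = update (update R b (R b + R a)) a 0 by rewrite /f subn0.
have e : f (R a) = R by rewrite /f; store_eq.
rewrite -[X in ev _ X _]e.
apply: ev_for => k; rewrite /f.
- by rewrite /update eqxx.
- by rewrite /update; repeat case: eqP => //; congruence.
- by move=> hk; apply: ev_eq (ev_add1 _ _) _; store_eq.
Qed.

Definition double a t := For a (Add1 t ;; Add1 t) ;; move_reg t a.

Lemma ev_double a t R : a <> t -> a <> 1 -> t <> 1 -> R 1 = 0 -> R t = 0 ->
  ev (double a t) R (update R a (R a).*2).
Proof.
move=> at_ a1 t1 R1 Rt.
pose f k := update (update R t ((R a - k).*2)) a k.
apply: (@ev_seq _ _ _ (f 0)).
  have e : f (R a) = R by rewrite /f; store_eq.
  rewrite -[X in ev _ X _]e.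
  apply: ev_for => k; rewrite /f.
  - by rewrite /update eqxx.
  - by rewrite /update; repeat case: eqP => //; congruence.
  - move=> hk; apply: ev_seq (ev_add1 _ _) _.
    by apply: ev_eq (ev_add1 _ _) _; store_eq.
apply: ev_eq (ev_move _ _ _ _) _; try congruence.
  by rewrite /f /update; repeat case: eqP => //; congruence.
rewrite /f; store_eq.
Qed.

(** The map iterated by [CodeSeq.code]; the coded empty list is 0. *)
Definition cons_code (k s : nat) : nat := 2 ^ k * s.*2.+1.

Lemma code_cons x l : code (x :: l) = cons_code x (code l).
Proof. by []. Qed.

Lemma cons_codeS k s : cons_code k.+1 s = (cons_code k s).*2.
Proof. by rewrite /cons_code expnS -mulnA mul2n. Qed.

(** One doubling and an increment give the odd factor of [cons_code]; the loop then doubles [k]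
    times. *)
Definition push k a t := double a t ;; Add1 a ;; For k (double a t).

Lemma ev_push k a t R :
  a <> t -> a <> k -> k <> t -> a <> 1 -> t <> 1 -> k <> 1 ->
  R 1 = 0 -> R t = 0 ->
  ev (push k a t) R (update (update R a (cons_code (R k) (R a))) k 0).
Proof.
move=> at_ ak kt a1 t1 k1 R1 Rt.
pose f i := update (update R a (cons_code (R k - i) (R a))) k i.
apply: ev_seq (ev_double _ _ _ _ _) _ => //.
apply: ev_seq (ev_add1 _ _) _.
have <- : f 0 = update (update R a (cons_code (R k) (R a))) k 0.
  by rewrite /f subn0.
have e : f (R k) = update (update R a (R a).*2) a (update R a (R a).*2 a).+1.
  by rewrite /f subnn /cons_code mul1n; store_eq.
rewrite -[X in ev _ X _]e; apply: ev_for => i; rewrite /f.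
- by rewrite /update eqxx.
- by rewrite /update; repeat case: eqP => //; congruence.
- move=> hi; apply: ev_eq (ev_double _ _ _ _ _) _ => //.
  + by rewrite /update; repeat case: eqP => //; congruence.
  + by rewrite /update; repeat case: eqP => //; congruence.
  + have -> : R k - i = (R k - i.+1).+1 by lia.
    rewrite cons_codeS; store_eq.
Qed.

Definition copy a b t := For a (Add1 b ;; Add1 t) ;; move_reg t a.

Lemma ev_copy a b t R : a <> b -> a <> t -> b <> t -> a <> 1 -> b <> 1 ->
  t <> 1 -> R 1 = 0 -> R t = 0 -> ev (copy a b t) R (update R b (R b + R a)).
Proof.
move=> ab at_ bt a1 b1 t1 R1 Rt.
pose f i := update (update (update R b (R b + (R a - i))) t (R a - i)) a i.
apply: (@ev_seq _ _ _ (f 0)).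
  have e : f (R a) = R by rewrite /f; store_eq.
  rewrite -[X in ev _ X _]e; apply: ev_for => i; rewrite /f.
  - by rewrite /update eqxx.
  - by rewrite /update; repeat case: eqP => //; congruence.
  - move=> hi; apply: ev_seq (ev_add1 _ _) _.
    by apply: ev_eq (ev_add1 _ _) _; store_eq.
apply: ev_eq (ev_move _ _ _ _) _; try congruence.
  by rewrite /f /update; repeat case: eqP => //; congruence.
rewrite /f; store_eq.
Qed.

Definition nop := For 1 (Add1 1).

Lemma ev_nop R : R 1 = 0 -> ev nop R R.
Proof. exact: ev_for0. Qed.

Fixpoint add_const b v := if v is v'.+1 then Add1 b ;; add_const b v' else nop.

Lemma ev_add_const b v R : b <> 1 -> R 1 = 0 ->
  ev (add_const b v) R (update R b (R b + v)).
Proof.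
move=> b1; elim: v R => [|v IH] R R1 /=.
  by apply: ev_eq (ev_nop R1) _; store_eq.
apply: ev_seq (ev_add1 _ _) _.
apply: ev_eq (IH _ _) _; first by rewrite /update; case: eqP => //; congruence.
store_eq.
Qed.

(** Each round removes a unit from register 0 and tries to remove a second: success adds to the
    quotient in register 4, failure records the odd remainder in register 5. *)
Definition halve := For 0 (If 0 (Add1 4) (Add1 5)).

Lemma ev_halve k (b : bool) R : R 0 = k.*2 + b -> R 1 = 0 ->
  ev halve R (update (update (update R 0 0) 4 (R 4 + k)) 5 (R 5 + b)).
Proof.
elim: k R => [|k IH] R R0 R1.
  case: b R0 => R0; last first.
    by apply: ev_eq (ev_for0 _ _) _ => //; store_eq.
  apply: ev_forS; rewrite ?R0 //.
  - by apply: ev_if0; first by []; apply: ev_add1.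
  - by [].
  - by apply: ev_eq (ev_for0 _ _) _ => //; store_eq.
apply: ev_forS; rewrite ?R0 //.
- apply: ev_ifS; first by rewrite /update /=; lia.
  + exact: ev_add1.
  + by [].
- by [].
- apply: ev_eq (IH _ _ _) _ => //.
  rewrite /update /=; apply: functional_extensionality => x.
  by repeat case: eqP => //; move=> *; subst; lia.
Qed.

(* Strips the trailing zeros of register 0, counting them in register 2, then the
   one that follows; register 6 is set as long as this one has not been met. *)
Definition pop_loop :=
  For 6 (halve ;; If 5 nop (Add1 2 ;; Add1 6) ;; move_reg 4 0).

Lemma ev_pop_loop a b R : R 0 = cons_code a b -> R 1 = 0 -> R 4 = 0 ->
  R 5 = 0 -> R 6 = 1 ->
  ev pop_loop R (update (update (update R 0 b) 2 (R 2 + a)) 6 0).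
Proof.
elim: a R => [|a IH] R R0 R1 R4 R5 R6.
  rewrite /cons_code mul1n -addn1 in R0.
  apply: ev_forS; rewrite ?R6 //.
  - apply: ev_seq; first by apply: (@ev_halve b true); rewrite // /update /= R0.
    apply: ev_seq.
      apply: ev_ifS; first by rewrite /update /= R5.
        by apply: ev_nop; rewrite /update /=.
      by rewrite /update /=.
    by apply: ev_move; rewrite // /update /=.
  - by rewrite /update /=.
  - apply: ev_eq (ev_for0 _ _) _; first by rewrite /update /=.
    by store_eq.
rewrite cons_codeS in R0.
apply: ev_forS; rewrite ?R6 //.
- apply: ev_seq.
    by apply: (@ev_halve (cons_code a b) false); rewrite // /update /= R0 addn0.
  apply: ev_seq.
    apply: ev_if0; first by rewrite /update /= R5.
    by apply: ev_seq (ev_add1 _ _) (ev_add1 _ _).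
  by apply: ev_move; rewrite // /update /=.
- by rewrite /update /=.
- apply: ev_eq (IH _ _ _ _ _ _) _; rewrite /update /= ?R4 ?R5 //.
  apply: functional_extensionality => x.
  by repeat case: eqP => //; move=> *; subst; lia.
Qed.

Definition pop := Add1 6 ;; pop_loop.

Lemma ev_pop a b R : R 0 = cons_code a b -> R 1 = 0 -> R 4 = 0 ->
  R 5 = 0 -> R 6 = 0 -> ev pop R (update (update R 0 b) 2 (R 2 + a)).
Proof.
move=> R0 R1 R4 R5 R6; apply: ev_seq (ev_add1 _ _) _.
apply: ev_eq (@ev_pop_loop a b _ _ _ _ _ _) _; rewrite /update /= ?R6 //.
by store_eq.
Qed.

(** * The program computing the code of an instance *)

(** Stores given by explicit lists let simplification compute updates. *)
Definition mk (l : seq nat) : store := fun r => nth 0 l r.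
Arguments mk l r /.

Lemma update_mk l r v : update (mk l) r v = mk (set_nth 0 l r v).
Proof.
by apply: functional_extensionality => x; rewrite /update /mk nth_set_nth.
Qed.

Arguments CodeSeq.code : simpl never.
Arguments cons_code : simpl never.
Arguments chain_edge_code : simpl never.
Arguments add_const : simpl never.

(* Registers 3 to 6 are temporaries, equal to zero between commands. *)
Definition regs n k b d m u v w f q x y : store :=
  mk [:: n; 0; k; 0; 0; 0; 0; b; d; m; u; v; w; f; q; x; y].

Ltac store_simpl := rewrite /regs ?update_mk /= ?add0n ?addn0.
Tactic Notation "step" uconstr(L) := eapply ev_seq; [by eapply L | store_simpl].
Tactic Notation "last_step" uconstr(L) := eapply ev_eq; [by eapply L | store_simpl].

Definition pair_code := push 11 12 3 ;; push 10 12 3 ;; move_reg 12 10.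

Lemma ev_pair n k b d m u v f q x y :
  ev pair_code (regs n k b d m u v 0 f q x y)
    (regs n k b d m (code [:: u; v]) 0 0 f q x y).
Proof.
step ev_push. step ev_push. last_step ev_move. by [].
Qed.

(** Builds the nested pairs of [chain_edge_code] from the inside out, with the source in register 10
    and the target in register 14, and pushes the result onto the list in register 8. *)
Definition emit l :=
  pair_code ;; add_const 11 l ;; pair_code ;; move_reg 14 11 ;; pair_code ;;
  add_const 11 1 ;; pair_code ;; push 10 8 3.

Lemma ev_emit l n k b d m u f q x y :
  ev (emit l) (regs n k b d m u 0 0 f q x y)
    (regs n k b (cons_code (chain_edge_code u l q) d) m 0 0 0 f 0 x y).
Proof.
step ev_pair. step ev_add_const. step ev_pair. step ev_move. step ev_pair.
step ev_add_const. step ev_pair. last_step ev_push. by [].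
Qed.

(** Codes are pushed in front, so the short edge, whose target [Sink] has number 0, precedes the
    load edge. *)
Definition chain_body :=
  copy 7 10 3 ;; copy 9 10 3 ;; emit 64 ;; copy 7 10 3 ;; copy 9 10 3 ;;
  copy 7 14 3 ;; copy 9 14 3 ;; Add1 14 ;; emit 8.

Lemma ev_chain n k b L m f x y :
  ev (For 9 chain_body) (regs n k b (code L) m 0 0 0 f 0 x y)
    (regs n k b (code (chain_codes b m L)) 0 0 0 0 f 0 x y).
Proof.
elim: m L => [|m IH] L; first exact: ev_for0.
apply: ev_forS; last 1 first.
- exact: IH.
- by [].
- rewrite /regs !update_mk /=.
  step ev_copy. step ev_copy. step ev_emit. step ev_copy. step ev_copy.
  step ev_copy. step ev_copy. step ev_add1. last_step ev_emit. by [].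
- by [].
Qed.

Definition full_body := copy 9 10 3 ;; Add1 11 ;; pair_code ;; push 10 13 3.

Lemma ev_full n k b d m L x y :
  ev (For 9 full_body) (regs n k b d m 0 0 0 (code L) 0 x y)
    (regs n k b d 0 0 0 0 (code (full_codes m L)) 0 x y).
Proof.
elim: m L => [|m IH] L; first exact: ev_for0.
apply: ev_forS; last 1 first.
- exact: IH.
- by [].
- rewrite /regs !update_mk /=.
  step ev_copy. step ev_add1. step ev_pair. last_step ev_push. by [].
- by [].
Qed.

Lemma ev_pop_code a l b d m u v w f q x y :
  ev pop (regs (code (a :: l)) 0 b d m u v w f q x y)
    (regs (code l) a b d m u v w f q x y).
Proof.
last_step (@ev_pop a (code l)). by [].
Qed.

Definition pop_push := pop ;; push 2 12 3.

Lemma ev_pop_push a l b d m u v L f q x y :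
  ev pop_push (regs (code (a :: l)) 0 b d m u v (code L) f q x y)
    (regs (code l) 0 b d m u v (code (a :: L)) f q x y).
Proof. step ev_pop_code. last_step ev_push. by []. Qed.

Fixpoint pop_pushes k := if k is k'.+1 then pop_push ;; pop_pushes k' else nop.

Arguments pop_pushes : simpl never.

Lemma ev_pop_pushes s l b d m u v L f q x y :
  ev (pop_pushes (size s)) (regs (code (s ++ l)) 0 b d m u v (code L) f q x y)
    (regs (code l) 0 b d m u v (code (rev s ++ L)) f q x y).
Proof.
elim: s L => [|a s IH] L; first exact: ev_nop.
apply: ev_seq; first exact: ev_pop_push.
by rewrite rev_cons cat_rcons.
Qed.

(* Register 0 holds the list [b, D, mid (reversed), s], which is also the length
   of the chain; the result is left in register 16. *)
Definition build_code :=
  copy 0 9 3 ;; pop ;; move_reg 2 7 ;; pop ;; move_reg 2 8 ;;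
  copy 7 10 3 ;; copy 9 10 3 ;; emit 8 ;;
  copy 7 15 3 ;; copy 9 15 3 ;; Add1 15 ;; For 9 chain_body ;;
  copy 15 9 3 ;; For 9 full_body ;;
  push 13 12 3 ;; push 8 12 3 ;; pop_pushes 8 ;; push 15 12 3 ;; pop_push ;;
  move_reg 12 16.

Lemma ev_build_code b D mid s n : size mid = 8 ->
  n = code [:: b, D & rev mid ++ [:: s]] ->
  ev build_code (update (fun=> 0) 0 n)
    (regs 0 0 b 0 0 0 0 0 0 0 0 (system_code s b D n mid)).
Proof.
move=> hm hn.
have -> : update (fun=> 0) 0 n = regs n 0 0 0 0 0 0 0 0 0 0 0.
  apply: functional_extensionality => r; rewrite /update /regs /=.
  by do 17 (case: r => [|r] //=); rewrite nth_nil.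
(* Register 9 keeps [n] as a number while register 0 is unpacked as a list. *)
step ev_copy. rewrite {1}hn.
step ev_pop_code. step ev_move. step ev_pop_code. step ev_move.
step ev_copy. step ev_copy. step ev_emit. step ev_copy. step ev_copy. step ev_add1.
rewrite -{1}[D]CodeSeq.decodeK -code_cons.
step ev_chain. step ev_copy. step (@ev_full _ _ _ _ _ [::]).
step ev_push. step ev_push.
rewrite -/(transitions_code b D n) -[cons_code _ (cons_code _ 0)]/(code [:: _; _]).
(* The fields are pushed from the last to the first; popping the reversed [mid] restores its
   order. *)
have -> : pop_pushes 8 = pop_pushes (size (rev mid)) by rewrite size_rev hm.
step (@ev_pop_pushes (rev mid) [:: s]).
step ev_push. rewrite revK -code_cons.
step (@ev_pop_push s [::]). last_step ev_move.
by [].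
Qed.

(** * Diagonalization *)

(** Jumps out of the program are cut down to its end, so that every way of halting continues with
    the code placed after it. *)
Definition relocate (k off sz : nat) (i : instruction) : instruction :=
  match i with
  | Inc r => Inc (k + r)
  | Dec r j => Dec (k + r) (off + minn j sz)
  end.

Lemma relocate_correct k pre p post t s R' : (fun r => R' (k + r)) = s.2 ->
  exists R1, (fun r => R1 (k + r)) = (iter t (rm_step p) s).2 /\
    reaches (pre ++ map (relocate k (size pre) (size p)) p ++ post)
      (size pre + minn s.1 (size p), R')
      (size pre + minn (iter t (rm_step p) s).1 (size p), R1).
Proof.
set P := pre ++ _; move=> e0; elim: t => [|t [R1 [e h]]].
  by exists R'; split=> //; apply: reaches_refl.
move: e h; rewrite iterS; case: (iter t _ s) => pc R /= e h.
have [lt|ge] := ltnP pc (size p); last first.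
  rewrite (onth_default ge) /=; exists R1; split=> //.
have [i hi] := onth_some lt.
suff [R2 [e2 h2]] : exists R2, (fun r => R2 (k + r)) = (rm_step p (pc, R)).2 /\
    rm_step P (size pre + pc, R1) =
    (size pre + minn (rm_step p (pc, R)).1 (size p), R2).
  exists R2; split=> //; apply: reaches_trans h _.
  by exists 1; rewrite (minn_idPl (ltnW lt)); apply: h2.
have hP : onth P (size pre + pc) = Some (relocate k (size pre) (size p) i).
  by rewrite onth_cat ltnNge leq_addr /= addKn onth_cat size_map lt onth_map hi.
rewrite /= hi hP -e {hP}.
have upd r v : (fun r0 => update R1 (k + r) v (k + r0)) =
    update (fun r0 => R1 (k + r0)) r v.
  apply: functional_extensionality => x.
  by rewrite /update eqn_add2l.
case: i hi => [r|r j] hi /=.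
  exists (update R1 (k + r) (R1 (k + r)).+1); split; first exact: upd.
  by rewrite (minn_idPl lt) addnS.
case: eqP => h0 /=; first by exists R1.
exists (update R1 (k + r) (R1 (k + r)).-1); split; first exact: upd.
by rewrite (minn_idPl lt) addnS.
Qed.

Lemma halted_iter P s t : size P <= s.1 -> iter t (rm_step P) s = s.
Proof.
by case: s => pc R h; elim: t => //= t ->; rewrite /= onth_default.
Qed.

(** A halted configuration is a fixed point of [rm_step], so halting earlier would persist at
    [s']. *)
Lemma halted_reaches P s s' :
  reaches P s s' -> (forall t, (iter t (rm_step P) s').1 < size P) ->
  forall t, (iter t (rm_step P) s).1 < size P.
Proof.
case=> t0 <- h t; rewrite ltnNge; apply/negP => ht.
have [le|/ltnW le] := leqP t0 t.
  by have := h (t - t0); rewrite -iterD subnK // ltnNge ht.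
by have := h 0; rewrite -(subnK le) iterD /= halted_iter // ltnNge ht.
Qed.

(** From register 16 on, the store is an initial store for a relocated program with input [x]. *)
Lemma build_code_output b x :
  (fun r => regs 0 0 b 0 0 0 0 0 0 0 0 x (16 + r)) = update (fun=> 0) 0 x.
Proof.
by apply: functional_extensionality => -[|r] //=; rewrite /regs /= nth_nil.
Qed.

(* Register [k] is the output of the relocated [p]: the last instruction loops
   forever when it is zero and otherwise falls off the program. *)
Definition then_halt_if (k : nat) (c p : seq instruction) : seq instruction :=
  c ++ map (relocate k (size c) (size p)) p ++ [:: Dec k (size c + size p)].

Lemma halts_then_halt_if k c p n x m R0 :
  (forall post, reaches (c ++ post) (rm_input n) (size c, R0)) ->
  (fun r => R0 (k + r)) = update (fun=> 0) 0 x ->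
  rm_computes p x m -> halts (then_halt_if k c p) n <-> 0 < m.
Proof.
move=> hc hR0 [t [hs hout]]; set P := then_halt_if k c p.
set L := size c + size p.
have sP : size P = L.+1.
  by rewrite /P /then_halt_if !size_cat size_map /= addnA addn1.
have [R [Rk hR]] : exists R, R k = m /\ reaches P (rm_input n) (L, R).
  have [R1 [e h2]] := @relocate_correct k c p [:: Dec k L] t (rm_input x) R0 hR0.
  exists R1; split; first by rewrite -hout -e addn0.
  apply: reaches_trans (hc _) _.
  by move: h2; rewrite min0n addn0 (minn_idPr hs).
have st : rm_step P (L, R) = if m == 0 then (L, R) else (L.+1, update R k m.-1).
  have hL : onth P L = Some (Dec k L).
    by rewrite /P /then_halt_if -/L catA onth_cat size_cat size_map ltnn subnn.
  by rewrite /= hL Rk.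
split.
- case=> T hT; rewrite lt0n; apply/negP => /eqP m0.
  have loop u : (iter u (rm_step P) (L, R)).1 < size P.
    suff -> : iter u (rm_step P) (L, R) = (L, R) by rewrite sP.
    by elim: u => // u IH; rewrite iterS IH st m0.
  by have := halted_reaches hR loop T; rewrite ltnNge hT.
- move=> m0; case: hR => u hu; exists u.+1.
  by rewrite iterS hu st (gtn_eqF m0) sP.
Qed.

Lemma bounded_program P : exists2 B, size P < B &
  all (fun i => instr_reg i < B) P.
Proof.
suff [M hM] : exists M, all (fun i => instr_reg i < M) P.
  exists (M + (size P).+1); first by lia.
  by apply: sub_all hM => i hi; rewrite ltn_addr.
elim: P => [|i P [M hM]]; first by exists 0.
exists (M + (instr_reg i).+1) => /=; apply/andP; split; first by lia.
by apply: sub_all hM => j hj; rewrite ltn_addr.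
Qed.

Theorem theorem15 :
  ~ decidable_on encode
      (fun x : mc_instance => Pi_controlled_class 2 2 (mc_formula x))
      (fun x : mc_instance => models (mc_system x) (mc_formula x)).
Proof.
case=> p hp; pose P := then_halt_if 16 (compile 0 build_code) p.
have [B sB rB] := bounded_program P.
have [s [D [mid [hm henc]]]] := encode_reduction sB.
(* The constants depend on [P], but [P] receives them through its input, so the self-reference is
   not circular. *)
pose n := code [:: base B, D & rev mid ++ [:: s]].
have [b [hb hbm]] := hp _ (reduction_in_class P B n).
rewrite henc in hb.
have hev := ev_build_code hm (erefl n).
have hU := halts_then_halt_if (compile_correct0 hev) (build_code_output _ _) hb.
have hM := models_reduction_halts n sB rB.
(* The answer true makes [P] halt on [n], so the formula fails; the answer false makes it loop, so
   the formula holds. *)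
case: b {hb} hbm hU => hbm hU.
- exact: (hM.1 (hbm.1 isT) (hU.2 isT)).
- by have := hbm.2 (hM.2 (fun h => notF (hU.1 h))).
Qed.
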